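(* Let $\mathcal{X}$ be a complex Banach space. If $A\in\mathcal{B}(\mathcal{X})$ is doubly-bounded, then $\operatorname{asc}(\delta_{A,B})=1$ for every power-bounded operator $B\in\mathcal{B}(\mathcal{X})$.
   Context: $\mathcal{B}(\mathcal{X})$ is the Banach algebra of all bounded linear operators on $\mathcal{X}$. The generalized derivation $\delta_{A,B}\colon\mathcal{B}(\mathcal{X})\to\mathcal{B}(\mathcal{X})$ is $\delta_{A,B}(X)=AX-XB$. An operator $T$ is power-bounded if there is a constant $K\geq 1$ with $\|T^n\|\leq K$ for all $n\in\mathbb{N}$. An operator $T\in\mathcal{B}(\mathcal{X})$ is doubly-bounded if $T$ has a left inverse $T^l\in\mathcal{B}(\mathcal{X})$ (that is, $T^lT=I$) such that both $T$ and $T^l$ are power-bounded. The ascent $\operatorname{asc}(T)$ is the smallest non-negative integer $k$ such that $\mathscr{N}(T^k)=\mathscr{N}(T^{k+1})$ (with $T^0=I$), where $\mathscr{N}$ denotes the null space, and $\infty$ if no such $k$ exists.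
   Formalization: The claim asc(δ_{A,B}) = 1 is proved when the null space of δ_{A,B} is non-zero; when δ_{A,B} is injective the ascent is 0 instead (e.g. A = I, B = 0 makes δ_{A,B} the identity), and this is what is proved in that case. *)

(* Defs.v *)
From HB Require Import structures.
From mathcomp Require Import all_boot all_order all_algebra.
From mathcomp Require Import complex.
From mathcomp Require Import boolp classical_sets functions reals topology.
From mathcomp Require Import normedtype.

Set Implicit Arguments.
Unset Strict Implicit.
Unset Printing Implicit Defensive.

Import Order.TTheory GRing.Theory Num.Theory.
Import numFieldNormedType.Exports.

Local Open Scope ring_scope.
Local Open Scope classical_set_scope.
Local Open Scope complex_scope.

(* The algebra B(X). It is only a [pzRingType]: X may be the zero space. *)
Record bop (R : realType) (X : normedModType R[i]) : Type := Bop {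
  bop_fun :> X -> X ;
  bop_linear : linear bop_fun ;
  bop_bounded : exists M : R[i], forall x, `|bop_fun x| <= M * `|x|
}.

HB.instance Definition _ (R : realType) (X : normedModType R[i]) (T : bop X) :=
  GRing.isLinear.Build R[i] X X _ (bop_fun T) (bop_linear T).

HB.instance Definition _ (R : realType) (X : normedModType R[i]) :=
  gen_eqMixin (bop X).
HB.instance Definition _ (R : realType) (X : normedModType R[i]) :=
  gen_choiceMixin (bop X).

Section BoundedOperators.
Context {R : realType} {X : normedModType R[i]}.
Implicit Types (S T : bop X) (a : R[i]).

Lemma bopP S T : (forall x, S x = T x) -> S = T.
Proof.
case: S T => [f fl fb] [g gl gb] /= /funext fg; subst g.
by congr Bop; exact: Prop_irrelevance.
Qed.

Lemma bop_bounded_ge0 T :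
  exists2 M : R[i], 0 <= M & forall x, `|T x| <= M * `|x|.
Proof.
have [M TM] := bop_bounded T; exists `|M| => // x.
have Mx : 0 <= M * `|x| by rewrite (le_trans _ (TM x)).
by rewrite (le_trans (TM x))// -(ger0_norm Mx) normrM normr_id.
Qed.

Fact bop_zero_linear : linear (fun _ : X => 0 : X).
Proof. by move=> a x y; rewrite scaler0 addr0. Qed.
Fact bop_zero_bounded :
  exists M : R[i], forall x : X, `|0 : X| <= M * `|x|.
Proof. by exists 0 => x; rewrite normr0 mul0r. Qed.
Definition bop_zero : bop X := Bop bop_zero_linear bop_zero_bounded.

Fact bop_opp_linear T : linear (fun x : X => - T x).
Proof. by move=> a x y; rewrite linearP opprD scalerN. Qed.
Fact bop_opp_bounded T : exists M : R[i], forall x, `|- T x| <= M * `|x|.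
Proof. by have [M TM] := bop_bounded T; exists M => x; rewrite normrN. Qed.
Definition bop_opp T : bop X := Bop (bop_opp_linear T) (bop_opp_bounded T).

Fact bop_add_linear S T : linear (fun x : X => S x + T x).
Proof. by move=> a x y; rewrite !linearP scalerDr addrACA. Qed.
Fact bop_add_bounded S T :
  exists M : R[i], forall x, `|S x + T x| <= M * `|x|.
Proof.
have [M SM] := bop_bounded S; have [N TN] := bop_bounded T.
exists (M + N) => x.
by rewrite mulrDl (le_trans (ler_normD _ _))// lerD.
Qed.
Definition bop_add S T : bop X :=
  Bop (bop_add_linear S T) (bop_add_bounded S T).

Fact bop_scale_linear a T : linear (fun x : X => a *: T x).
Proof. by move=> b x y; rewrite linearP scalerDr !scalerA mulrC. Qed.
Fact bop_scale_bounded a T :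
  exists M : R[i], forall x, `|a *: T x| <= M * `|x|.
Proof.
have [M TM] := bop_bounded T; exists (`|a| * M) => x.
by rewrite normrZ -mulrA ler_wpM2l.
Qed.
Definition bop_scale a T : bop X :=
  Bop (bop_scale_linear a T) (bop_scale_bounded a T).

Fact bop_one_linear : linear (fun x : X => x).
Proof. by []. Qed.
Fact bop_one_bounded : exists M : R[i], forall x : X, `|x| <= M * `|x|.
Proof. by exists 1 => x; rewrite mul1r. Qed.
Definition bop_one : bop X := Bop bop_one_linear bop_one_bounded.

Fact bop_mul_linear S T : linear (S \o T : X -> X).
Proof. by move=> a x y; rewrite /= !linearP. Qed.
Fact bop_mul_bounded S T :
  exists M : R[i], forall x, `|(S \o T) x| <= M * `|x|.
Proof.
have [M M0 SM] := bop_bounded_ge0 S; have [N TN] := bop_bounded T.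
by exists (M * N) => x; rewrite (le_trans (SM _))// -mulrA ler_wpM2l.
Qed.
Definition bop_mul S T : bop X :=
  Bop (bop_mul_linear S T) (bop_mul_bounded S T).

Fact bop_addA : associative bop_add.
Proof. by move=> S T U; apply: bopP => x /=; rewrite addrA. Qed.
Fact bop_addC : commutative bop_add.
Proof. by move=> S T; apply: bopP => x /=; rewrite addrC. Qed.
Fact bop_add0 : left_id bop_zero bop_add.
Proof. by move=> T; apply: bopP => x /=; rewrite add0r. Qed.
Fact bop_addN : left_inverse bop_zero bop_opp bop_add.
Proof. by move=> T; apply: bopP => x /=; rewrite addNr. Qed.

HB.instance Definition _ :=
  GRing.isZmodule.Build (bop X) bop_addA bop_addC bop_add0 bop_addN.

Fact bop_mulA : associative bop_mul.
Proof. by move=> S T U; apply: bopP. Qed.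
Fact bop_mul1l : left_id bop_one bop_mul.
Proof. by move=> T; apply: bopP. Qed.
Fact bop_mul1r : right_id bop_one bop_mul.
Proof. by move=> T; apply: bopP. Qed.
Fact bop_mulDl : left_distributive bop_mul +%R.
Proof. by move=> S T U; apply: bopP. Qed.
Fact bop_mulDr : right_distributive bop_mul +%R.
Proof. by move=> S T U; apply: bopP => x /=; rewrite linearD. Qed.

HB.instance Definition _ := GRing.Zmodule_isPzRing.Build (bop X)
  bop_mulA bop_mul1l bop_mul1r bop_mulDl bop_mulDr.

Fact bop_scaleA a b T : bop_scale a (bop_scale b T) = bop_scale (a * b) T.
Proof. by apply: bopP => x /=; rewrite scalerA. Qed.
Fact bop_scale1 : left_id 1 bop_scale.
Proof. by move=> T; apply: bopP => x /=; rewrite scale1r. Qed.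
Fact bop_scaleDr : right_distributive bop_scale +%R.
Proof. by move=> a S T; apply: bopP => x /=; rewrite scalerDr. Qed.
Fact bop_scaleDl T : {morph bop_scale^~ T : a b / a + b}.
Proof. by move=> a b; apply: bopP => x /=; rewrite scalerDl. Qed.

HB.instance Definition _ := GRing.Zmodule_isLmodule.Build R[i] (bop X)
  bop_scaleA bop_scale1 bop_scaleDr bop_scaleDl.

(* [`|T x|] is a nonnegative real in R[i]; [complex.Re] reads it in R, where
   suprema exist. *)
Definition opnorm T : R :=
  sup [set complex.Re `|T x| | x in [set x : X | `|x| <= 1]].

Definition power_bounded T : Prop :=
  exists2 K : R, 1 <= K & forall n, opnorm (T ^+ n) <= K.

Definition doubly_bounded T : Prop :=
  exists Tl : bop X, [/\ Tl * T = 1, power_bounded T & power_bounded Tl].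

Definition gen_derivation (A B : bop X) : bop X -> bop X :=
  fun S => A * S - S * B.

Fact gen_derivation_linear (A B : bop X) : linear (gen_derivation A B).
Proof.
move=> a S T; apply: bopP => x.
by rewrite /gen_derivation /= linearP scalerBr opprD addrACA.
Qed.

HB.instance Definition _ (A B : bop X) := GRing.isLinear.Build R[i]
  (bop X) (bop X) _ (gen_derivation A B) (gen_derivation_linear A B).

End BoundedOperators.

Definition null_space (K : pzRingType) (V : lmodType K) (f : V -> V) : set V :=
  [set v | f v = 0].

(* [None] stands for infinite ascent. *)
Definition ascent (K : pzRingType) (V : lmodType K) (T : {linear V -> V}) :
    option nat :=
  let stable k := `[< null_space (iter k T) = null_space (iter k.+1 T) >] in
  if pselect (exists k, stable k) is left ex_k then Some (ex_minn ex_k)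
  else None.

(* Main.v *)
(* Suppose delta X = Y and delta Y = 0, where delta = delta_{A,B}.  Since
   A Y = Y B, induction gives A^(n+1) X - X B^(n+1) = (n+1) A^n Y.  Multiplying
   by the n-th power of the left inverse of A yields
   (n+1) Y = Tl^n (A^(n+1) X - X B^(n+1)), whose right-hand side is bounded
   uniformly in n; hence Y = 0 and N(delta^2) = N(delta). *)

Require Import Defs.
From mathcomp Require Import all_boot all_order all_algebra complex.
From mathcomp Require Import boolp classical_sets reals topology normedtype.

Local Open Scope ring_scope.
Local Open Scope classical_set_scope.
Local Open Scope complex_scope.

Import Order.TTheory GRing.Theory Num.Theory.

Lemma ger0_complexE (R : realType) (x : R[i]) :
  0 <= x -> x = (complex.Re x)%:C.
Proof. by case: x => a b; rewrite lecE /= => /andP[/eqP-> _]. Qed.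

Lemma complex_Re_ge0 (R : realType) (x : R[i]) : 0 <= x -> 0 <= complex.Re x.
Proof. by case: x => a b; rewrite lecE /= => /andP[]. Qed.

Section OperatorNorm.
Context {R : realType} {X : normedModType R[i]}.
Implicit Types (T : bop X) (x : X).

Lemma norm_le_opnorm T x : `|T x| <= (opnorm T)%:C * `|x|.
Proof.
have [->|x0] := eqVneq x 0; first by rewrite linear0 !normr0 mulr0.
have nx : 0 < `|x| by rewrite normr_gt0.
pose y : X := `|x|^-1 *: x.
have ny : `|y| = 1 by rewrite normrZ normfV normr_id mulVf// gt_eqF.
have -> : `|T x| = `|T y| * `|x|.
  by rewrite linearZ /= normrZ normfV normr_id mulrAC mulVf ?mul1r// gt_eqF.
rewrite ler_wpM2r// [`|T y|]ger0_complexE// lecR.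
apply: ub_le_sup; last by exists y => //=; rewrite ny.
(* The supremum dominates its members only if the set is bounded above; on the unit ball
   [complex.Re M] is such a bound. *)
have [M M0 TM] := bop_bounded_ge0 T.
exists (complex.Re M) => _ [z /= z1 <-].
rewrite -lecR -!ger0_complexE//.
by rewrite (le_trans (TM z))// ler_piMr.
Qed.

Lemma bop_mulrnE T n x : (T *+ n) x = T x *+ n.
Proof. by elim: n => // n IHn; rewrite !mulrS -IHn. Qed.

(** Pointwise bounds with a constant in [R[i]] can be chained along a product of operators without
    returning to [opnorm]. *)
Lemma power_boundedP T : power_bounded T ->
  exists2 K : R[i], 0 <= K & forall n x, `|(T ^+ n) x| <= K * `|x|.
Proof.
case=> K K1 TK; exists K%:C => [|n x].
  by rewrite (_ : 0 = 0%:C)// lecR (le_trans ler01).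
by rewrite (le_trans (norm_le_opnorm _ _))// ler_wpM2r// lecR.
Qed.

End OperatorNorm.

(** The Archimedean property, applied to real parts because it is available in [R]. *)
Lemma bounded_mulrn_eq0 (R : realType) (X : normedModType R[i]) (y : X)
    (C : R[i]) : (forall n, `|y *+ n.+1| <= C) -> y = 0.
Proof.
move=> yC; apply/eqP; rewrite -normr_eq0; apply/eqP.
have C0 : 0 <= C by exact: le_trans (yC 0).
have yR n : complex.Re `|y| *+ n.+1 <= complex.Re C.
  rewrite -lecR -(ger0_complexE _ _ C0) (le_trans _ (yC n))// normrMn.
  by rewrite (rmorphMn (real_complex R) _ _ : _%:C = _%:C *+ _) -ger0_complexE.
have Ry0 : 0 <= complex.Re `|y| by exact: complex_Re_ge0.
rewrite [LHS]ger0_complexE//; suff -> : complex.Re `|y| = 0 by [].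
apply/eqP/negPn/negP => Ry.
have Rygt : 0 < complex.Re `|y| by rewrite lt_def Ry.
have CR : 0 <= complex.Re C / complex.Re `|y|.
  by rewrite divr_ge0// complex_Re_ge0.
(* This [n] satisfies [C < n * |y|] in real parts; passing to [n.+1] only enlarges the right side,
   against [yR n]. *)
have := archi_boundP CR; set n := Num.bound _.
rewrite ltr_pdivrMr// mulr_natl => /lt_le_trans/(_ (ler_wpMn2l Ry0 (leqnSn n))).
by rewrite ltNge yR.
Qed.

(** Telescoping: in the inductive step the difference splits into [a ^+ n.+1 * (a * x - x * b)], one
    copy of [a ^+ n.+1 * y], and the previous difference times [b], which gives [n.+1] copies once
    [b] is moved across [y]. *)
Lemma exprS_intertwine (S : pzRingType) (a b x y : S) n :
  a * x - x * b = y -> a * y = y * b ->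
  a ^+ n.+1 * x - x * b ^+ n.+1 = (a ^+ n * y) *+ n.+1.
Proof.
move=> axb ayb; elim: n => [|n IHn]; first by rewrite !expr1 expr0 mul1r.
have anyb m : a ^+ m * y * b = a ^+ m.+1 * y.
  by rewrite -mulrA -ayb mulrA -exprSr.
have -> : a ^+ n.+2 * x - x * b ^+ n.+2 =
    a ^+ n.+1 * (a * x - x * b) + (a ^+ n.+1 * x - x * b ^+ n.+1) * b.
  rewrite mulrBr mulrBl (exprSr a) (exprSr b n.+1) !mulrA.
  by rewrite addrA subrK.
by rewrite axb IHn mulrnAl anyb -mulrS.
Qed.

Lemma expr_left_inverse (S : pzRingType) (a al : S) n :
  al * a = 1 -> al ^+ n * a ^+ n = 1.
Proof.
move=> ala; elim: n => [|n IHn]; first by rewrite mul1r.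
by rewrite exprSr exprS mulrA -(mulrA _ al) ala mulr1.
Qed.

Lemma gen_derivation_sqr_eq0 (R : realType) (X : normedModType R[i])
    (A B S : bop X) : doubly_bounded A -> power_bounded B ->
  gen_derivation A B (gen_derivation A B S) = 0 -> gen_derivation A B S = 0.
Proof.
case=> Al [AlA /power_boundedP[K K0 AK] /power_boundedP[L L0 AlL]].
case/power_boundedP=> M M0 BM.
set Y := gen_derivation A B S => /subr0_eq AYB.
have [N N0 SN] := bop_bounded_ge0 S.
apply: bopP => x.
(* [L], [K] and [M] bound all powers of [Al], [A] and [B], and [N] bounds [S], so the constant
   depends on [x] but not on [n]. *)
apply: (@bounded_mulrn_eq0 _ _ _ (L * (K * (N * `|x|) + N * (M * `|x|)))) => n.
have YE : Y *+ n.+1 = Al ^+ n * (A ^+ n.+1 * S - S * B ^+ n.+1).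
  rewrite (@exprS_intertwine _ A B S Y)// mulrnAr mulrA.
  by rewrite expr_left_inverse// mul1r.
rewrite -bop_mulrnE YE (le_trans (AlL _ _))// ler_wpM2l// (le_trans (ler_normB _ _))//.
apply: lerD; first by rewrite (le_trans (AK _ _))// ler_wpM2l.
by rewrite (le_trans (SN _))// ler_wpM2l.
Qed.

Lemma ascent_eqSome (K : pzRingType) (V : lmodType K) (T : {linear V -> V}) k :
  null_space (iter k T) = null_space (iter k.+1 T) ->
  (forall j, (j < k)%N ->
     null_space (iter j T) <> null_space (iter j.+1 T)) ->
  ascent T = Some k.
Proof.
move=> kP kmin; rewrite /ascent; case: pselect => [ex_k|]; last first.
  by case; exists k; apply/asboolP.
congr Some; case: ex_minnP => m /asboolP mP mmin.
apply/eqP; rewrite eqn_leq mmin/=; last exact/asboolP.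
by rewrite leqNgt; apply/negP => /kmin.
Qed.

(** An injective derivation has ascent 0, as happens for [A = 1] and [B = 0]; hence the two
    cases. *)
Theorem corollary5 (R : realType) (X : completeNormedModType R[i])
    (A : bop X) (hA : doubly_bounded A) (B : bop X) (hB : power_bounded B) :
  (null_space (gen_derivation A B) <> [set 0] ->
     ascent (gen_derivation A B) = Some 1%N) /\
  (null_space (gen_derivation A B) = [set 0] ->
     ascent (gen_derivation A B) = Some 0%N).
Proof.
split=> [N0|N0]; apply: ascent_eqSome => //.
- apply/seteqP; split=> S /= SN; last exact: gen_derivation_sqr_eq0 SN.
  by rewrite /null_space /= (SN : gen_derivation A B S = 0) linear0.
(* Only [j = 0] remains, and the null space of the identity is [[set 0]] by conversion. *)
- by case=> // _ /esym.
Qed.
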